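(* Let $\alpha\in(0,1)$ be fixed. Consider the family of null hypotheses $\mathcal{C}=\{H_{0i}=\{\eta_i\le\delta\}: i\in[1,k]\}$ with alternatives $H_{Ai}:\eta_i>\delta$, and the following multiple testing procedure: for each $i\in[1,k]$, assert $H_{Ai}$ (i.e. not $H_{0i}$) if $R_i=R_{c_1,\dots,c_i}$ occurs, where $c_1,\dots,c_k$ are the critical constants determined by $\alpha$ as described in the context. Then the experimentwise error rate is at most $\alpha$; i.e., for every parameter value $(\mu_0,\dots,\mu_k)\in H$ and $\sigma>0$, the probability of making at least one incorrect assertion (asserting $H_{Ai}$ for some $i$ for which $H_{0i}$ is true) is at most $\alpha$.
   Context: Integer intervals: $[a,b]$ denotes the set of integers from $a$ to $b$. Model: $Y_{ij}=\mu_i+\varepsilon_{ij}$ for $i=0,\dots,k$, $j=1,\dots,n_i$, with independent errors $\varepsilon_{ij}\sim N(0,\sigma^2)$, $\sigma^2$ unknown. The parameter space is $H=\{\underline{\mu}=(\mu_0,\mu_1,\dots,\mu_k):\mu_1\le\cdots\le\mu_k\}$ (together with $\sigma>0$). $\bar{Y}_i$ are the sample means, $S^2$ is the mean squared error with $\nu=\sum_{i=0}^k n_i-(k+1)$ degrees of freedom, so $\nu S^2/\sigma^2\sim\chi^2_\nu$ independently of the $\bar{Y}_i$. $\delta\ge0$ is a given constant, $\eta_i=\mu_i-\mu_0$, and $H_{0i}=\{\eta_i\le\delta\}$ is regarded as a subset of $H$. For $1\le i\le j\le k$ put $n_{i,j}=\sum_{h=i}^j n_h$ and $\bar{Y}_{i,j}=\frac{1}{n_{i,j}}\sum_{h=i}^j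 n_h\bar{Y}_h$. SDMMSA estimators $\hat{\mu}_1,\dots,\hat{\mu}_k$: set $i_0=k+1$. Given $i_{u-1}>1$, let $i_u$ be the smallest $j\in[1,i_{u-1}-1]$ such that $\bar{Y}_{j,i_{u-1}-1}=\max_{1\le j'\le i_{u-1}-1}\bar{Y}_{j',i_{u-1}-1}$, and define $\hat{\mu}_i=\bar{Y}_{i_u,i_{u-1}-1}$ for all $i\in[i_u,i_{u-1}-1]$. Stop at the first $u=h$ with $i_h=1$. Rejection regions: for constants $c_1,\dots,c_i$, $$R_{c_1,\dots,c_i}=\bigcup_{j=1}^i\left\{\frac{\hat{\mu}_j-\bar{Y}_0-\delta}{S}>c_j\right\}.$$ Critical constants: $c_1=t_{\alpha,\nu}\sqrt{1/n_1+1/n_0}$, where $t_{\alpha,\nu}$ is the upper $\alpha$ quantile of the $t$-distribution with $\nu$ degrees of freedom; for $i=2,\dots,k$, $c_i$ is determined iteratively as the solution of $P_{\underline{\mu}_i}(R_{c_1,\dots,c_i})=\alpha$, where $\underline{\mu}_i=(\mu_0,\mu_1,\dots,\mu_k)$ has $\mu_1=\cdots=\mu_i=\mu_0+\delta$ and $\mu_{i+1}=\cdots=\mu_k=+\infty$ (probabilities with infinite means are understood as limits as those means tend to $+\infty$; this probability does not depend on $\mu_0$ or $\sigma$). *)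

(* Defs.v *)
From HB Require Import structures.
From mathcomp Require Import all_boot all_order all_algebra.
From mathcomp Require Import all_classical all_reals all_analysis.
From mathcomp Require Import measurable_realfun.

Set Implicit Arguments.
Unset Strict Implicit.
Unset Printing Implicit Defensive.

Import Order.TTheory GRing.Theory Num.Theory.
Import numFieldNormedType.Exports.

Local Open Scope classical_set_scope.
Local Open Scope ring_scope.

Section student.
Context {R : realType}.

(* measurableTypeR R is R with the Borel sigma-algebra, on which normal_prob is
   defined. *)
Definition add_square (vz : R * measurableTypeR R) : R := vz.1 + vz.2 ^+ 2.

Lemma measurable_add_square :
  measurable_fun [set: (R * measurableTypeR R)%type] add_square.
Proof.
by apply: measurable_funD => //; apply: measurable_funX.
Qed.

HB.instance Definition _ :=
  isMeasurableFun.Build _ _ _ _ add_square measurable_add_square.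

(* Law of the sum of nu squared independent standard normal variables. *)
Fixpoint chi2_prob (nu : nat) : probability R R :=
  if nu is m.+1 then distribution (chi2_prob m \x normal_prob 0 1)%E add_square
  else \d_(0 : R).

(* Law of Z / sqrt (V / nu) with Z ~ N(0, 1) and V ~ chi2(nu) independent. *)
Definition student_prob (nu : nat) : set R -> \bar R :=
  pushforward (normal_prob 0 1 \x chi2_prob nu)%E
    (fun zv : R * R => zv.1 / Num.sqrt (zv.2 / nu%:R)).

Definition is_student_upper_quantile (alpha : R) (nu : nat) (t : R) : Prop :=
  student_prob nu `]t, +oo[ = alpha%:E.

End student.

Section statistics.
Context {R : realType} {k : nat} (n : 'I_k.+1 -> nat).

(* Group 0 is the control.  The j-th observation of group i is y i j, with j
   running over 0, ..., n i - 1. *)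
Implicit Type y : forall i, 'I_(n i) -> R.

Definition sample_mean y (i : 'I_k.+1) : R :=
  (\sum_(j < n i) y i j) / (n i)%:R.

Definition error_df : nat := (\sum_(i < k.+1) n i - k.+1)%N.

(* S, the square root of the mean squared error. *)
Definition root_mse y : R :=
  Num.sqrt ((\sum_(i < k.+1) \sum_(j < n i) (y i j - sample_mean y i) ^+ 2)
            / error_df%:R).

Definition pooled_mean y (i j : nat) : R :=
  (\sum_(h < k.+1 | (i <= h <= j)%N) (n h)%:R * sample_mean y h)
  / (\sum_(h < k.+1 | (i <= h <= j)%N) n h)%:R.

(* The smallest j in [1, r] maximizing pooled_mean y j r, for r >= 1. *)
Definition block_start y (r : nat) : nat :=
  head 1%N [seq j <- index_iota 1 r.+1 |
    all (fun j' => pooled_mean y j' r <= pooled_mean y j r)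
        (index_iota 1 r.+1)].

(* i_0 = k + 1 > i_1 > i_2 > ... ; meaningful up to the first index at which
   the value is 1. *)
Definition breakpoint y (u : nat) : nat :=
  iter u (fun r => block_start y r.-1) k.+1.

(* For 1 <= i <= k the block containing i is [i_u, i_(u-1) - 1] with u the
   first index such that i_u <= i; it satisfies 1 <= u <= k. *)
Definition sdmmsa y (i : nat) : R :=
  let u := find (fun v => breakpoint y v <= i)%N (iota 0 k.+1) in
  pooled_mean y (breakpoint y u) (breakpoint y u.-1).-1.

End statistics.

Section procedure.
Context {R : realType} {k : nat} (n : 'I_k.+1 -> nat).
Context {d : measure_display} {T : measurableType d}.
Variable Y : forall i, 'I_(n i) -> {mfun T >-> R}.
(* P mu sigma is the law governing the experiment when the group means are
   mu and the error standard deviation is sigma. *)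
Variable P : ('I_k.+1 -> R) -> R -> probability T R.
Variables delta alpha : R.

Implicit Types (mu : 'I_k.+1 -> R) (c : nat -> R).

Definition mutually_independent (Q : probability T R) (I : finType)
    (X : I -> T -> R) : Prop :=
  forall B : I -> set R, (forall i, measurable (B i)) ->
    Q (\bigcap_(i in [set: I]) X i @^-1` B i)
    = (\prod_(i : I) Q (X i @^-1` B i))%E.

(* The monotone part of mu starts at index 1: mu_0 is unconstrained. *)
Definition param_space : set ('I_k.+1 -> R) :=
  [set mu | forall i j : 'I_k.+1, (1 <= i <= j)%N -> mu i <= mu j].

Definition error mu (s : {i : 'I_k.+1 & 'I_(n i)}) (w : T) : R :=
  Y (tagged s) w - mu (tag s).

Definition normal_one_way_model : Prop :=
  forall mu (sigma : R), mu \in param_space -> 0 < sigma ->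
    mutually_independent (P mu sigma) (error mu) /\
    forall s (A : set R), measurable A ->
      P mu sigma (error mu s @^-1` A) = normal_prob 0 sigma A.

Definition data (w : T) : forall i, 'I_(n i) -> R := fun i j => Y j w.

Definition rejection_region c (i : nat) : set T :=
  \bigcup_(j in [set j | (1 <= j <= i)%N])
    [set w | c j < (sdmmsa (data w) j - sample_mean (data w) ord0 - delta)
                   / root_mse (data w)].

(* Convergence of mu in the parameter space to the configuration
   (m0, m0 + delta, ..., m0 + delta, +oo, ..., +oo) with i finite entries
   m0 + delta: the finite entries are held fixed and those of index > i tend
   jointly to +oo. *)
Definition least_favorable (m0 : R) (i : nat) : set_system ('I_k.+1 -> R) :=
  filter_from [set: R] (fun M => [set mu | [/\ mu \in param_space,
    mu ord0 = m0,
    forall j : 'I_k.+1, (1 <= j <= i)%N -> mu j = m0 + delta &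
    forall j : 'I_k.+1, (i < j)%N -> M <= mu j]]).

Global Instance least_favorable_filter (m0 : R) (i : nat) :
  ProperFilter (least_favorable m0 i).
Proof.
apply: Build_ProperFilter_ex.
  move=> A [M _ MA]; exists (fun j : 'I_k.+1 => if (j == 0 :> nat)%N then m0
    else if (j <= i)%N then m0 + delta else Num.max M (m0 + delta)).
  apply: MA; split => //=.
  - rewrite inE => a b /andP[a1 ab] /=.
    rewrite !gtn_eqF// ?(leq_trans a1)//.
    case: (leqP a i) => ai; case: (leqP b i) => bi //.
      by rewrite le_max lexx orbT.
    by have := leq_ltn_trans bi ai; rewrite ltnNge ab.
  - by move=> j /andP[j1 ji]; rewrite gtn_eqF// ji.
  - move=> j ij; rewrite gtn_eqF ?(leq_ltn_trans _ ij)// leqNgt ij/=.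
    by rewrite le_max lexx.
apply: filter_from_filter; first by exists 0.
move=> M N _ _; exists (Num.max M N) => //.
by move=> mu [? ? ? H]; split; split => // j /H;
  rewrite ge_max => /andP[].
Qed.

(* The limiting probability defining c_i does not depend on the control mean
   nor on the standard deviation, so that the reference values m0 and sigma0
   at which it is computed are arbitrary.  inord 1 is index 1 when k >= 1. *)
Definition critical_constants (m0 sigma0 : R) c : Prop :=
  (exists2 t : R, is_student_upper_quantile alpha (error_df n) t &
     c 1%N = t * Num.sqrt ((n (inord 1))%:R^-1 + (n ord0)%:R^-1)) /\
  forall i, (2 <= i <= k)%N ->
    P mu sigma0 (rejection_region c i) @[mu --> least_favorable m0 i]
      --> alpha%:E.

Definition null_hypothesis (i : 'I_k.+1) : set ('I_k.+1 -> R) :=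
  [set mu | mu \in param_space /\ mu i - mu ord0 <= delta].

Definition incorrect_assertion c mu : set T :=
  \bigcup_(i in [set i : 'I_k.+1 | (1 <= i)%N /\ mu \in null_hypothesis i])
    rejection_region c i.

End procedure.

(* Main.v *)
Require Import Defs.
From mathcomp Require Import all_boot all_order all_algebra.
From mathcomp Require Import all_classical all_reals all_analysis.
From mathcomp Require Import measurable_realfun ring lra zify.

Set Implicit Arguments.
Unset Strict Implicit.
Unset Printing Implicit Defensive.

Import Order.TTheory GRing.Theory Num.Theory.
Import numFieldNormedType.Exports.

Local Open Scope classical_set_scope.
Local Open Scope ring_scope.

(** Since the means mu_1 <= ... <= mu_k are ordered, the true null hypotheses are
those of index 1, ..., q for some q.  Since R_i increases with i, an incorrect
assertion is made exactly when R_q occurs.  If there is no true null there is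
nothing to prove.

The estimators are the isotonic regression of the sample means, so
mu^_j = min_(t >= j) max_(s <= j) of the pooled means of the groups s, ..., t
(sdmmsa_minmax).  They are therefore nondecreasing in each sample mean of
index >= 1.  Writing the data as mu + sigma x, where the errors x are independent
standard normals, the event R_q becomes a set of values of x which depends on mu
and sigma only through the shifts (mu_h - mu_0 - delta) / sigma, h >= 1, and
which increases with each of them (standardized_rejection_mono).  The law of x
does not depend on the parameters (std_normal_family_law); so the probability of
R_q is nondecreasing in the shifts (rejection_prob_mono).

If q >= 2, then the first q shifts are nonpositive, while in the least favorable
configuration they are 0 and the other ones tend to infinity.  The probability
of R_q is hence at most its limit there, which is alpha by the choice of c_q.

If q = 1, then mu^_1 is at most the mean of group 1 and the first shift is
nonpositive; so R_1 implies that the standardized difference between the error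
means of groups 1 and 0 exceeds t_(alpha, nu), which has probability alpha by the
definition of Student's law.  That this ratio has Student's law
(two_sample_student) is proved with plane rotations only.  A rotation of two
coordinates of an independent standard normal family gives such a family again
(std_normal_family_rotate), by the rotational symmetry of the Gaussian law of the
plane.  Helmert's transformation is a product of such rotations; in each group it
moves the normalized mean to one coordinate and leaves the residual sum of
squares as the sum of the squares of the others. *)

(** * The standard Gaussian law of the plane is invariant under rotation *)

(** The pushforward bundled as a measure, for a map that is measurable by a proof
given explicitly rather than by a declared structure. *)
Definition image_measure d d' (T1 : measurableType d) (T2 : measurableType d')
    (R : realFieldType) (m : {measure set T1 -> \bar R}) (f : T1 -> T2)
    (mf : measurable_fun [set: T1] f) : {measure set T2 -> \bar R} :=
  measure_function_pushforward__canonical__measure_function_Measure m mf.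

Lemma affine_preimage_ocitv (R : realType) (a b u v : R) : 0 < a ->
  (fun x : R => a * x + b) @^-1` `]u, v] = `](u - b) / a, (v - b) / a]%classic.
Proof.
move=> a0; apply/seteqP; split => x /=; rewrite !in_itv/=.
  by move=> /andP[ux xv]; rewrite ltr_pdivrMr// ler_pdivlMr// ltrBlDr lerBrDr mulrC ux.
by rewrite ltr_pdivrMr// ler_pdivlMr// ltrBlDr lerBrDr (mulrC x).
Qed.

Section density_integral.
Context {d} {T : measurableType d} {R : realType}.
Variables (m : {measure set T -> \bar R}) (g : T -> R).
Hypotheses (mg : measurable_fun [set: T] g) (g0 : forall x, 0 <= g x).
Variable nu : {measure set T -> \bar R}.
Hypothesis densityE : forall A, measurable A ->
  nu A = (\int[m]_(x in A) (g x)%:E)%E.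
Local Open Scope ereal_scope.
Import HBNNSimple.

Let integral_density_indic (A : set T) : measurable A ->
  \int[nu]_x (\1_A x)%:E = \int[m]_x ((\1_A x)%:E * (g x)%:E).
Proof.
move=> mA; rewrite integral_indic// setIT densityE//.
rewrite integral_mkcond; apply: eq_integral => x _.
by rewrite patchE indicE; case: (x \in A); rewrite ?mul1e ?mul0e.
Qed.

Let integral_density_nnsfun (h : {nnsfun T >-> R}) :
  \int[nu]_x (h x)%:E = \int[m]_x ((h x)%:E * (g x)%:E).
Proof.
under [LHS]eq_integral do rewrite fimfunE -fsumEFin//.
rewrite [LHS]ge0_integral_fsum//; last 2 first.
  - by move=> r; exact/measurable_EFinP/measurableT_comp.
  - by move=> n x _; rewrite EFinM nnfun_muleindic_ge0.
under [RHS]eq_integral.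
  move=> x xD; rewrite fimfunE -fsumEFin// ge0_mule_fsuml; last first.
    by move=> r; rewrite EFinM nnfun_muleindic_ge0.
  over.
rewrite [RHS]ge0_integral_fsum//; last 2 first.
  - move=> r; apply: emeasurable_funM; last exact/measurable_EFinP.
    by apply/measurable_EFinP; exact: measurable_funM.
  - move=> n x _; apply: mule_ge0; last by rewrite lee_fin.
    by rewrite EFinM nnfun_muleindic_ge0.
apply: eq_fsbigr => r; rewrite inE => -[z _ <-].
under eq_integral do rewrite EFinM.
rewrite ge0_integralZl//; last 2 first.
  - exact/measurable_EFinP.
  - by rewrite lee_fin.
rewrite integral_density_indic// -ge0_integralZl//.
- by apply: eq_integral => x _; rewrite EFinM muleA.
- by apply: emeasurable_funM; exact/measurable_EFinP.
- by move=> x _; rewrite mule_ge0 ?lee_fin.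
- by rewrite lee_fin.
Qed.

(** True for indicators by hypothesis, for simple functions by linearity, and in
general by monotone convergence. *)
Lemma integral_density (f : T -> \bar R) :
  measurable_fun [set: T] f -> (forall x, 0 <= f x) ->
  \int[nu]_x f x = \int[m]_x (f x * (g x)%:E).
Proof.
move=> mf f0; pose f_ := nnsfun_approx measurableT mf.
have f_cvg x : (f_ n x)%:E @[n --> \oo] --> f x by exact: cvg_nnsfun_approx.
have f_nd x : {homo (fun n => (f_ n x)%:E) : a b / (a <= b)%N >-> a <= b}.
  by move=> a b ab; rewrite lee_fin; exact/lefP/nd_nnsfun_approx.
transitivity (limn (fun n => \int[nu]_x (f_ n x)%:E)).
  rewrite -monotone_convergence//=.
  - by apply: eq_integral => x _; apply/esym/cvg_lim.
  - by move=> n; apply/measurable_EFinP.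
  - by move=> n x _; rewrite lee_fin.
under eq_fun do rewrite integral_density_nnsfun.
rewrite -monotone_convergence//=.
- by apply: eq_integral => x _; apply/cvg_lim => //; exact: cvgeZr.
- move=> n; apply: emeasurable_funM; exact/measurable_EFinP.
- by move=> n x _; rewrite mule_ge0 ?lee_fin.
- by move=> x _ a b ab; rewrite lee_wpmul2r ?lee_fin//; exact: f_nd.
Qed.

End density_integral.

Section gaussian_plane.
Context {R : realType}.
Local Notation leb := (@lebesgue_measure R).
Local Notation N01 := (normal_prob (0 : R) 1).
Local Open Scope ereal_scope.

Lemma measurable_affine (a b : R) :
  measurable_fun [set: measurableTypeR R]
    (fun x : measurableTypeR R => (a * x + b)%R : measurableTypeR R).
Proof. by apply: measurable_funD => //; apply: measurable_funM. Qed.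

(** Both sides are measures in A that agree on half-open intervals, which
determine the Lebesgue measure. *)
Lemma lebesgue_measure_affine (a b : R) (a0 : (0 < a)%R) (A : set R) :
  measurable A ->
  a%:E * leb ((fun x : R => a * x + b)%R @^-1` A) = leb A.
Proof.
move=> mA.
pose a' := NngNum (ltW a0).
pose m := image_measure leb (measurable_affine a b).
apply/esym; rewrite (@lebesgue_measure_unique R (mscale a' m))//=.
move=> _ [[u v]] _ <-.
transitivity (a%:E * leb (`](u - b) / a, (v - b) / a]%classic : set R)%R);
  last by rewrite -affine_preimage_ocitv.
rewrite !lebesgue_measure_itv/=.
rewrite !lte_fin ltr_pM2r ?invr_gt0// ltrD2r; case: ifP => _; last by rewrite mule0.
by rewrite -!EFinD -EFinM -mulrBl mulrCA divff ?gt_eqF// mulr1; congr EFin; ring.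
Qed.

Lemma integral_affine (a b : R) (f : R -> \bar R) : (0 < a)%R ->
  measurable_fun [set: R] f -> (forall x, 0 <= f x) ->
  a%:E * \int[leb]_x f (a * x + b)%R = \int[leb]_x f x.
Proof.
move=> a0 mf f0.
pose a' := NngNum (ltW a0).
pose m := image_measure leb (measurable_affine a b).
transitivity (\int[mscale a' m]_x f x).
  rewrite ge0_integral_mscale//=; congr (_ * _).
  by rewrite (ge0_integral_pushforward (measurable_affine a b)).
apply: eq_measure_integral => A mA _ /=.
exact: lebesgue_measure_affine.
Qed.

(** Two one-dimensional substitutions replace a change of variables in the
plane.  By Tonelli, integrate over x first and put u = c x - s y; since
c^2 + s^2 = 1, the second argument becomes s x + c y = (y + s u) / c.  Then, for
fixed u, put v = (y + s u) / c.  The two Jacobians 1 / c and c cancel. *)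
Lemma integral_rotation (c s : R) (f1 f2 : R -> \bar R) : (0 < c)%R ->
  (c ^+ 2 + s ^+ 2 = 1)%R ->
  measurable_fun [set: R] f1 -> measurable_fun [set: R] f2 ->
  (forall x, 0 <= f1 x) -> (forall x, 0 <= f2 x) ->
  \int[leb]_x \int[leb]_y (f1 (c * x - s * y)%R * f2 (s * x + c * y)%R) =
  (\int[leb]_x f1 x) * (\int[leb]_y f2 y).
Proof.
move=> c0 cs mf1 mf2 f10 f20.
have swap (F : R * R -> \bar R) : (forall z, 0 <= F z) ->
    measurable_fun [set: (R * R)%type] F ->
    \int[leb]_x \int[leb]_y F (x, y) = \int[leb]_y \int[leb]_x F (x, y).
  by move=> F0 mF; exact: (@fubini_tonelli _ _ _ _ _ leb leb F mF F0).
have mf (f : R -> \bar R) (a b : R) : measurable_fun [set: R] f ->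
    measurable_fun [set: (R * R)%type] (fun z => f (a * z.1 + b * z.2)%R).
  move=> mf; apply: (measurableT_comp mf).
  by apply: measurable_funD; apply: measurable_funM.
have mf' (f : R -> \bar R) (a b : R) : measurable_fun [set: R] f ->
    measurable_fun [set: R] (fun y => f (a * y + b)%R).
  move=> mf''; apply: (measurableT_comp mf'').
  by apply: measurable_funD => //; apply: measurable_funM.
rewrite (swap (fun z => f1 (c * z.1 - s * z.2)%R * f2 (s * z.1 + c * z.2)%R)); last 2 first.
- by move=> z; rewrite mule_ge0.
- apply: emeasurable_funM; last exact: mf.
  by under eq_fun do rewrite -mulNr; exact: mf.
move=> /=.
have inner y : \int[leb]_x (f1 (c * x - s * y)%R * f2 (s * x + c * y)%R) =
    c^-1%:E * \int[leb]_u (f1 u * f2 (c^-1 * y + s / c * u)%R).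
  rewrite -(@integral_affine c (- (s * y))%R
    (fun u => f1 u * f2 (c^-1 * y + s / c * u)%R))//; first last.
  - by move=> x; rewrite mule_ge0.
  - apply: emeasurable_funM => //.
    rewrite (_ : (fun u => f2 _) = fun u => f2 (s / c * u + c^-1 * y)%R).
      exact: mf'.
    by apply/funext => u; rewrite addrC.
  rewrite muleA -EFinM mulVf ?gt_eqF// mul1e.
  apply: eq_integral => x _; congr (_ * f2 _).
  have -> : (s * x + c * y = s * x + (c ^+ 2 + s ^+ 2 - s ^+ 2) / c * y)%R.
    by rewrite addrK; field; rewrite gt_eqF.
  by rewrite cs; field; rewrite gt_eqF.
under eq_integral do rewrite inner.
have mF : measurable_fun [set: (R * R)%type]
    (fun z => f1 z.2 * f2 (c^-1 * z.1 + s / c * z.2)%R).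
  by apply: emeasurable_funM; [exact: (measurableT_comp mf1)|exact: mf].
have F0 (z : R * R) : 0 <= f1 z.2 * f2 (c^-1 * z.1 + s / c * z.2)%R.
  by rewrite mule_ge0.
rewrite ge0_integralZl//; first last.
- by rewrite lee_fin invr_ge0 ltW.
- by move=> y _; apply: integral_ge0 => u _; exact: (F0 (y, u)).
- exact: (@measurable_fun_fubini_tonelli_F _ _ _ _ _ leb _ mF F0).
rewrite (swap (fun z => f1 z.2 * f2 (c^-1 * z.1 + s / c * z.2)%R))//=.
have outer u : \int[leb]_y (f1 u * f2 (c^-1 * y + s / c * u)%R) =
    (c%:E * \int[leb]_y f2 y) * f1 u.
  rewrite ge0_integralZl//; last exact: mf'.
  rewrite -(@integral_affine c^-1%R (s / c * u)%R f2) ?invr_gt0//.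
  by rewrite muleA -EFinM divff ?gt_eqF// mul1e muleC.
under eq_integral do rewrite outer.
rewrite ge0_integralZl//; last first.
  by apply: mule_ge0; [rewrite lee_fin ltW|exact: integral_ge0].
by rewrite !muleA -EFinM mulVf ?gt_eqF// mul1e muleC.
Qed.

(** The joint density depends only on x^2 + y^2, which the rotation preserves. *)
Lemma normal_pdf_rotation (c s x y : R) : (c ^+ 2 + s ^+ 2 = 1)%R ->
  (normal_pdf 0 1 x * normal_pdf 0 1 y =
   normal_pdf 0 1 (c * x - s * y) * normal_pdf 0 1 (s * x + c * y))%R.
Proof.
move=> cs; rewrite normal_pdfE ?oner_eq0// /normal_fun !subr0.
rewrite mulrACA [RHS]mulrACA -!expRD; congr (_ * expR _)%R.
rewrite -!mulrDl -!opprD; congr (- _ * _)%R.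
transitivity ((c ^+ 2 + s ^+ 2) * (x ^+ 2 + y ^+ 2))%R; last by ring.
by rewrite cs mul1r.
Qed.

Lemma integral_normal_prob (f : R -> \bar R) :
  measurable_fun [set: R] f -> (forall x, 0 <= f x) ->
  \int[N01]_x f x = \int[leb]_x (f x * (normal_pdf 0 1 x)%:E).
Proof.
apply: (@integral_density _ (measurableTypeR R) R leb (normal_pdf 0 1)) => //.
- exact: measurable_normal_pdf.
- exact: normal_pdf_ge0.
Qed.

Lemma measurable_rotated_rectangle (c s : R) (B1 B2 : set R) :
  measurable B1 -> measurable B2 ->
  measurable [set z : R * R | B1 (c * z.1 - s * z.2)%R /\
                              B2 (s * z.1 + c * z.2)%R].
Proof.
move=> mB1 mB2.
have mlin (a b : R) : measurable_fun [set: (R * R)%type]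
    (fun z : R * R => a * z.1 + b * z.2)%R.
  by apply: measurable_funD; apply: measurable_funM.
rewrite -[X in measurable X]setTI (_ : [set z | _] =
    (fun z : R * R => c * z.1 - s * z.2)%R @^-1` B1 `&`
    (fun z : R * R => s * z.1 + c * z.2)%R @^-1` B2)//.
rewrite setIIr; apply: measurableI; last exact: mlin.
under [X in X @^-1` _]eq_fun do rewrite -mulNr.
exact: mlin.
Qed.

(** Rotational symmetry of the standard Gaussian law of the plane, on rectangles:
after normal_pdf_rotation the integrand is a product of a function of each
rotated coordinate, so integral_rotation applies. *)
Lemma normal_prob_rotation (c s : R) (B1 B2 : set R) : (0 < c)%R ->
  (c ^+ 2 + s ^+ 2 = 1)%R -> measurable B1 -> measurable B2 ->
  (N01 \x N01) [set z : R * R | B1 (c * z.1 - s * z.2)%R /\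
                               B2 (s * z.1 + c * z.2)%R] =
  N01 B1 * N01 B2.
Proof.
move=> c0 cs mB1 mB2; set Q := (X in (_ \x _) X).
pose h (B : set R) x := (\1_B x * normal_pdf 0 1 x)%:E : \bar R.
have mh (B : set R) : measurable B -> measurable_fun [set: R] (h B).
  move=> mB; apply/measurable_EFinP; apply: measurable_funM => //.
  exact: measurable_normal_pdf.
have h0 B x : 0 <= h B x by rewrite lee_fin mulr_ge0// normal_pdf_ge0.
have hE B : \int[leb]_x h B x = N01 B.
  rewrite /normal_prob [RHS]integral_mkcond; apply: eq_integral => x _.
  by rewrite /h patchE indicE; case: (x \in B); rewrite ?mul1r ?mul0r.
have mQ : measurable Q by exact: measurable_rotated_rectangle.
transitivity (\int[leb]_x (N01 (xsection Q x) * (normal_pdf 0 1 x)%:E)).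
  apply: integral_normal_prob => //.
  exact: measurable_fun_xsection.
rewrite -(hE B1) -(hE B2) -(integral_rotation c0 cs)//; try exact: mh.
apply: eq_integral => x _; rewrite muleC.
rewrite [N01 (xsection Q x)](esym (hE (xsection Q x))).
have mhx : measurable_fun [set: R] (h (xsection Q x)).
  by apply: mh; exact: measurable_xsection.
have hx0 (y : measurableTypeR R) : setT y -> 0 <= h (xsection Q x) y by [].
have pdf0 : 0 <= (normal_pdf 0 1 x)%:E by rewrite lee_fin normal_pdf_ge0.
rewrite [LHS](esym (ge0_integralZl leb measurableT mhx hx0 pdf0)).
apply: eq_integral => y _; rewrite /h -!EFinM; congr EFin.
rewrite mulrCA (normal_pdf_rotation x y cs) (mulrACA (\1_B1 _)).
congr (_ * _)%R; rewrite !indicE -natrM mulnb.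
have -> // : (y \in xsection Q x) =
  ((c * x - s * y)%R \in B1) && ((s * x + c * y)%R \in B2).
by rewrite mem_xsection; apply/idP/andP; rewrite !inE.
Qed.

End gaussian_plane.

(** * Independent standard normal variables: rotations and sums of squares *)

Lemma measurable_invr (R : realType) : measurable_fun [set: R] (@GRing.inv R).
Proof.
rewrite -(setvU [set (0 : R)]); apply/measurable_funU => //.
  exact: measurableC.
split; last exact: measurable_fun_set1.
apply: open_continuous_measurable_fun.
  by apply: closed_openC; exact: closed_eq.
by move=> x; rewrite inE/= => /eqP; exact: inv_continuous.
Qed.

Lemma measurable_sqrtr (R : realType) : measurable_fun [set: R] (@Num.sqrt R).
Proof. by apply: continuous_measurable_fun; exact: sqrt_continuous. Qed.

Section independent_standard_normals.
Context {d : measure_display} {T : measurableType d} {R : realType}.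
Variable Q : probability T R.
Local Notation N01 := (normal_prob (0 : R) 1).
Local Open Scope ereal_scope.

(** If W has independent coordinates on rectangles and is independent of F, the
product formula extends from rectangles to all events of the plane.  Keeping F
lets one modify two members of an independent family while the event F carries
all the others. *)
Lemma pair_law_on_event d1 d2 (T1 : measurableType d1) (T2 : measurableType d2)
    (m1 : probability T1 R) (m2 : probability T2 R) (W : T -> T1 * T2)
    (F : set T) : measurable_fun [set: T] W -> measurable F ->
  (forall B1 B2, measurable B1 -> measurable B2 ->
    Q (W @^-1` (B1 `*` B2) `&` F) = m1 B1 * m2 B2 * Q F) ->
  forall C, measurable C -> Q (W @^-1` C `&` F) = (m1 \x m2) C * Q F.
Proof.
move=> mW mF rectE C mC.
have mWC : measurable (W @^-1` C) by rewrite -[_ @^-1` _]setTI; exact: mW.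
(* Uniqueness of the product measure is applied to the law of W given F, which
   needs Q F to be nonzero. *)
have [QF0|QF_neq0] := eqVneq (Q F) 0.
  rewrite QF0 mule0; apply/eqP; rewrite -measure_le0 -QF0.
  by apply: le_measure; rewrite ?inE//; exact: measurableI.
have QFfin : Q F \is a fin_num by exact: fin_num_measure.
have QF_gt0 : (0 < fine (Q F))%R.
  by rewrite fine_gt0// lt0e QF_neq0 measure_ge0 -ge0_fin_numE.
pose nu := image_measure (mrestr Q mF) mW.
have p_ge0 : (0 <= (fine (Q F))^-1)%R by rewrite invr_ge0 ltW.
rewrite (@product_measure_unique _ _ _ _ _ m1 m2 (mscale (NngNum p_ge0) nu))//.
  rewrite /mscale/= /pushforward /mrestr -{2}(fineK QFfin) muleAC -EFinM.
  by rewrite mulVf ?gt_eqF// mul1e.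
move=> B1 B2 mB1 mB2.
transitivity ((fine (Q F))^-1%:E * Q (W @^-1` (B1 `*` B2) `&` F)) => //.
by rewrite rectE// -{2}(fineK QFfin) muleCA -EFinM mulVf ?gt_eqF// mule1.
Qed.

Definition std_normal_family (I : finType) (X : I -> T -> R) : Prop :=
  (forall i, measurable_fun [set: T] (X i)) /\
  forall B : I -> set R, (forall i, measurable (B i)) ->
    Q (\bigcap_(i in [set: I]) X i @^-1` B i) = \prod_(i : I) N01 (B i).

Section family.
Variables (I : finType) (X : I -> T -> R).
Hypothesis hX : std_normal_family X.

Lemma std_normal_family_event (A : pred I) (B : I -> set R) :
  (forall i, measurable (B i)) ->
  Q (\bigcap_(i in [set i | A i]) X i @^-1` B i) =
  \prod_(i : I | A i) N01 (B i).
Proof.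
move=> mB; rewrite big_mkcond/=.
rewrite (eq_bigr (fun i => N01 (if A i then B i else setT))); last first.
  by move=> i _; case: ifP => // _; rewrite probability_setT.
rewrite -hX.2; last by move=> i; case: ifP.
congr (Q _); apply/seteqP; split => w /= Xw i; last first.
  by move=> /= Ai; have := Xw i Logic.I; rewrite /= Ai.
by move=> _ /=; case: ifPn => // Ai; exact: Xw.
Qed.

Lemma measurable_std_normal_event (A : pred I) (B : I -> set R) :
  (forall i, measurable (B i)) ->
  measurable (\bigcap_(i in [set i | A i]) X i @^-1` B i).
Proof.
move=> mB; apply: fin_bigcap_measurable => // i _.
by rewrite -[_ @^-1` _]setTI; exact: hX.1.
Qed.

Definition rotate_pair (i j : I) (c s : R) : I -> T -> R := fun l w =>
  (if l == i then c * X i w - s * X j w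
   else if l == j then s * X i w + c * X j w else X l w)%R.

(** Conditioning on the coordinates other than i and j, the pair (X i, X j) is a
standard Gaussian vector of the plane, whose law is unchanged by rotation. *)
Lemma std_normal_family_rotate (i j : I) (c s : R) : i != j ->
  (0 < c)%R -> (c ^+ 2 + s ^+ 2 = 1)%R ->
  std_normal_family (rotate_pair i j c s).
Proof.
move=> ij c0 cs; have [mX XE] := hX; split.
  move=> l; rewrite /rotate_pair; case: eqP => _.
    by apply: measurable_funB; apply: measurable_funM.
  by case: eqP => _ //; apply: measurable_funD; apply: measurable_funM.
move=> B mB.
pose A := [pred l | (l != i) && (l != j)].
pose F := \bigcap_(l in [set l | A l]) X l @^-1` B l.
pose W w := (X i w, X j w).
pose C := [set z : R * R | B i (c * z.1 - s * z.2)%R /\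
                           B j (s * z.1 + c * z.2)%R].
have ji : j != i by rewrite eq_sym.
have mC : measurable C by exact: measurable_rotated_rectangle.
transitivity (Q (W @^-1` C `&` F)).
  congr (Q _); apply/seteqP; split => w /=.
    move=> Xw; split; last first.
      by move=> l /= /andP[/negbTE li /negbTE lj]; have := Xw l Logic.I;
        rewrite /rotate_pair/= li lj.
    split; first by have := Xw i Logic.I; rewrite /rotate_pair/= eqxx.
    by have := Xw j Logic.I; rewrite /rotate_pair/= (negbTE ji) eqxx.
  move=> [[Ci Cj] Fw] l _ /=; rewrite /rotate_pair.
  have [->//|li] := eqVneq l i; have [->//|lj] := eqVneq l j.
  by apply: Fw; rewrite /= li lj.
have mF : measurable F by exact: measurable_std_normal_event.
have QF : Q F = \prod_(l | A l) N01 (B l) by exact: std_normal_family_event.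
rewrite (@pair_law_on_event _ _ _ _ N01 N01)//; first last.
- move=> B1 B2 mB1 mB2.
  pose B' l := if l == i then B1 else if l == j then B2 else B l.
  transitivity (Q (\bigcap_(l in [set: I]) X l @^-1` B' l)).
    congr (Q _); apply/seteqP; split => w /=.
      move=> [[B1w B2w] Fw] l _; rewrite /= /B'.
      have [->//|li] := eqVneq l i; have [->//|lj] := eqVneq l j.
      by apply: Fw; rewrite /= li lj.
    move=> Xw; split.
      split; first by have := Xw i Logic.I; rewrite /= /B' eqxx.
      by have := Xw j Logic.I; rewrite /= /B' (negbTE ji) eqxx.
    by move=> l /= /andP[/negbTE li /negbTE lj]; have := Xw l Logic.I;
        rewrite /B'/= li lj.
  rewrite XE; last by move=> l; rewrite /B'; case: ifP => // _; case: ifP.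
  rewrite (bigD1 i)//= (bigD1 j)//= {1 2}/B' eqxx (negbTE ji) eqxx muleA QF.
  congr (_ * _); apply: eq_bigr => l /andP[/negbTE li /negbTE lj].
  by rewrite /B' li lj.
- by apply: (@measurable_fun_pair _ _ _ T (measurableTypeR R) (measurableTypeR R)); exact: mX.
by rewrite normal_prob_rotation// QF [RHS](bigD1 i)//= [in RHS](bigD1 j)//= muleA.
Qed.

(** The recursion that defines the chi-square law adds one independent squared
normal at a time.  The induction needs the coordinates that do not enter the sum
in the statement, because the next square is taken from them. *)
Lemma sum_squares_law (t : seq I) (C : set R) (B : I -> set R) : uniq t ->
  measurable C -> (forall i, measurable (B i)) ->
  Q ((fun w => \sum_(i <- t) X i w ^+ 2)%R @^-1` C `&`
     \bigcap_(l in [set l | l \notin t]) X l @^-1` B l) =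
  chi2_prob (size t) C * \prod_(l : I | l \notin t) N01 (B l).
Proof.
have [mX XE] := hX.
have msum t' : measurable_fun [set: T]
    (fun w => \sum_(i <- t') X i w ^+ 2)%R.
  by apply: measurable_sum => i; exact: measurable_funX.
elim: t C B => [|a t IH] C B; first move=> _ mC mB.
  rewrite -(std_normal_family_event [pred l | l \notin [::]] mB) /=.
  rewrite (_ : _ @^-1` C = [set w | C 0]%R); last first.
    by apply/seteqP; split => w /=; rewrite big_nil.
  rewrite diracE; have [C0|C0] := boolP (0%R \in C).
    rewrite mul1e; congr (Q _); apply/seteqP; split => w //=; first by case.
    by move=> ?; split => //; move: C0; rewrite inE.
  rewrite mul0e -[RHS](measure0 Q); congr (Q _); apply/seteqP; split => w //=.
  by case => /mem_set; rewrite (negbTE C0).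
move=> /= /andP[at_ ut] mC mB.
pose V w := (\sum_(i <- t) X i w ^+ 2)%R.
pose F := \bigcap_(l in [set l | l \notin a :: t]) X l @^-1` B l.
pose W w := (V w, X a w).
have QF : Q F = \prod_(l | l \notin a :: t) N01 (B l).
  exact: std_normal_family_event.
have mF : measurable F by exact: measurable_std_normal_event.
transitivity (Q (W @^-1` (add_square @^-1` C) `&` F)).
  congr (Q (_ `&` _)); apply/seteqP; split => w /=.
    by rewrite big_cons addrC.
  by rewrite big_cons addrC.
rewrite -QF.
apply: (@pair_law_on_event _ _ _ _ (chi2_prob (size t)) N01) => //; first 1 last.
- move=> B1 B2 mB1 mB2.
  pose B' l := if l == a then B2 else B l.
  transitivity (Q (V @^-1` B1 `&`
      \bigcap_(l in [set l | l \notin t]) X l @^-1` B' l)).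
    congr (Q _); apply/seteqP; split => w /=.
      move=> [[Vw Xw] Fw]; split => // l /= lt; rewrite /= /B'.
      case: eqVneq => [->//|la]; apply: Fw.
      by rewrite /= inE negb_or la.
    move=> [Vw Xw]; split; first split => //.
      by have := Xw a at_; rewrite /= /B' eqxx.
    move=> l /=; rewrite inE negb_or => /andP[/negbTE la lt].
    by have := Xw l lt; rewrite /= /B' la.
  rewrite IH//; last by move=> l; rewrite /B'; case: ifP.
  rewrite (bigD1 a)//= {1}/B' eqxx muleA QF; congr (_ * _).
  apply: eq_big => l; first by rewrite inE negb_or andbC.
  by move=> /andP[_ /negbTE la]; rewrite /B' la.
- rewrite -[_ @^-1` _]setTI; exact: measurable_add_square.
- apply: (@measurable_fun_pair _ _ _ T R (measurableTypeR R)); [exact: msum|exact: mX].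
Qed.

Lemma normal_chi2_law (a : I) (t : seq I) (C : set (R * R)) :
  a \notin t -> uniq t -> measurable C ->
  Q ((fun w => (X a w, \sum_(i <- t) X i w ^+ 2)%R) @^-1` C) =
  (N01 \x chi2_prob (size t)) C.
Proof.
move=> at_ ut mC; have [mX XE] := hX.
rewrite -[_ @^-1` C]setIT -[RHS]mule1 -(@probability_setT _ _ _ Q).
apply: (@pair_law_on_event _ _ (measurableTypeR R) R N01 (chi2_prob (size t))) => //.
  apply: (@measurable_fun_pair _ _ _ T (measurableTypeR R) R); first exact: mX.
  by apply: measurable_sum => i; exact: measurable_funX.
move=> B1 B2 mB1 mB2; rewrite setIT probability_setT mule1.
pose B l := if l == a then B1 else setT.
transitivity (Q ((fun w => \sum_(i <- t) X i w ^+ 2)%R @^-1` B2 `&`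
     \bigcap_(l in [set l | l \notin t]) X l @^-1` B l)).
  congr (Q _); apply/seteqP; split => w /=.
    move=> [B1w B2w]; split => // l lt; rewrite /= /B.
    by case: eqVneq => // ->.
  by move=> [B2w Xw]; split => //; have := Xw a at_; rewrite /= /B eqxx.
rewrite sum_squares_law//; last by move=> l; rewrite /B; case: ifP.
rewrite muleC; congr (_ * _); rewrite (bigD1 a)//= {1}/B eqxx big1 ?mule1//.
by move=> l /andP[_ /negbTE la]; rewrite /B la probability_setT.
Qed.

End family.

End independent_standard_normals.

(** * Helmert's transformation *)

Section helmert.
Context {d : measure_display} {T : measurableType d} {R : realType}.
Variable Q : probability T R.
Variable I : finType.
Implicit Types (X : I -> T -> R) (a b : I) (l : seq I).

(** Helmert's transformation, one plane rotation per observation: if X a already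
holds S / sqrt m, where S is the sum of the first m observations, the rotation
of the plane of (a, b) with cosine sqrt (m / (m + 1)) turns it into
(S + X b) / sqrt (m + 1).  Rotations preserve the total sum of squares, so what
the other coordinates carry is the sum of squares minus the square of the
normalized sum, with no need to compute them. *)
Lemma helmert_rotation X a l : std_normal_family Q X -> uniq (a :: l) ->
  exists X', [/\ std_normal_family Q X',
    forall w, X' a w = (\sum_(i <- a :: l) X i w) / Num.sqrt (size l).+1%:R,
    forall i, i \notin a :: l -> X' i = X i &
    forall w, \sum_(i <- l) X' i w ^+ 2 =
      \sum_(i <- a :: l) X i w ^+ 2 - X' a w ^+ 2].
Proof.
move=> hX; elim: l => [|b l IH] /=.
  move=> _; exists X; split => // w; first by rewrite big_seq1 sqrtr1 divr1.
  by rewrite big_nil big_seq1 subrr.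
rewrite inE negb_or -andbA => /and4P[ab al bl ul].
have [|X1 [hX1 X1a X1out X1sq]] := IH; first by rewrite /= al.
pose m : R := (size l).+1%:R.
have m0 : 0 < m by rewrite ltr0n.
have m10 : 0 < m + 1 by rewrite addr_gt0.
have mE : (size l).+2%:R = m + 1 :> R by rewrite /m natr1.
(* rotate_pair sends coordinate a to c X_a - s X_b, hence the sign of s. *)
pose c := Num.sqrt m / Num.sqrt (m + 1); pose s : R := - (Num.sqrt (m + 1))^-1.
have sm0 : Num.sqrt m != 0 by rewrite gt_eqF// sqrtr_gt0.
have sm10 : Num.sqrt (m + 1) != 0 by rewrite gt_eqF// sqrtr_gt0.
have cs : c ^+ 2 + s ^+ 2 = 1.
  rewrite /c /s sqrrN expr_div_n exprVn !sqr_sqrtr ?ltW//.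
  by rewrite -[X in _ + X]mul1r -mulrDl divff ?gt_eqF.
exists (rotate_pair X1 a b c s); split.
- apply: std_normal_family_rotate => //.
  by rewrite /c divr_gt0 // sqrtr_gt0.
- move=> w; rewrite /rotate_pair eqxx X1a X1out ?inE ?negb_or 1?eq_sym ?ab//.
  rewrite !big_cons mE -/m /c /s; field.
  by rewrite sm0 sm10.
- move=> i; rewrite !inE !negb_or => /and3P[ia ib il].
  by apply/funext => w; rewrite /rotate_pair (negbTE ia) (negbTE ib) X1out// inE negb_or ia.
- move=> w; rewrite big_cons.
  have -> : \sum_(j <- l) rotate_pair X1 a b c s j w ^+ 2 =
      \sum_(j <- l) X1 j w ^+ 2.
    apply: eq_big_seq => j jl; rewrite /rotate_pair.
    case: eqVneq => [ja|_]; first by move: al; rewrite -ja jl.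
    by case: eqVneq => [jb|_] //; move: bl; rewrite -jb jl.
  have Xb : X1 b = X b by rewrite X1out// inE negb_or eq_sym ab.
  rewrite X1sq /rotate_pair eqxx eq_sym (negbTE ab) eqxx Xb !big_cons.
  have : (c ^+ 2 + s ^+ 2) * (X1 a w ^+ 2 + X b w ^+ 2) = X1 a w ^+ 2 + X b w ^+ 2.
    by rewrite cs mul1r.
  by move=> H; apply/eqP; rewrite -subr_eq0; apply/eqP; lra.
Qed.

Section groups.
Variables (G : finType) (g : I -> G) (a : G -> I).
Hypothesis ga : cancel a g.
Local Notation N u := #|[pred i | g i == u]|.

(** Helmert's transformation inside each group: a selects the coordinate of the
group that receives the normalized sum. *)
Lemma helmert_groups X : std_normal_family Q X ->
  exists X', [/\ std_normal_family Q X',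
    forall u w, X' (a u) w =
      (\sum_(i | g i == u) X i w) / Num.sqrt (N u)%:R &
    forall w, \sum_(i | i != a (g i)) X' i w ^+ 2 =
      \sum_u (\sum_(i | g i == u) X i w ^+ 2
              - (\sum_(i | g i == u) X i w) ^+ 2 / (N u)%:R)].
Proof.
move=> hX.
pose l u := [seq i <- enum I | (g i == u) && (i != a u)].
have mem_l u i : (i \in l u) = (g i == u) && (i != a u).
  by rewrite mem_filter mem_enum andbT.
have mem_al u i : (i \in a u :: l u) = (g i == u).
  rewrite inE mem_l; have [->|ia] := eqVneq i (a u); first by rewrite ga eqxx.
  by rewrite andbT.
have ual u : uniq (a u :: l u).
  by rewrite /= mem_l eqxx andbF filter_uniq ?enum_uniq.
have sum_l (F : I -> R) u :
    \sum_(i <- l u) F i = \sum_(i | (g i == u) && (i != a u)) F i.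
  by rewrite big_filter big_enum_cond.
have sum_al (F : I -> R) u : \sum_(i <- a u :: l u) F i = \sum_(i | g i == u) F i.
  by rewrite big_cons sum_l [RHS](bigD1 (a u)) ?ga.
have size_al u : (size (l u)).+1 = N u.
  rewrite -[LHS]/(size (a u :: l u)) -(card_uniqP (ual u)).
  by apply: eq_card => i; rewrite mem_al.
have N0 u : 0 < (N u)%:R :> R by rewrite -size_al ltr0n.
suff [X' [hX' X'in _]] : exists X', [/\ std_normal_family Q X',
    forall u, u \in enum G -> forall w,
      X' (a u) w = (\sum_(i | g i == u) X i w) / Num.sqrt (N u)%:R /\
      \sum_(i | (g i == u) && (i != a u)) X' i w ^+ 2 =
      \sum_(i | g i == u) X i w ^+ 2
        - (\sum_(i | g i == u) X i w) ^+ 2 / (N u)%:R &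
    forall i, g i \notin enum G -> X' i = X i].
  exists X'; split => // [u w|w]; first by have [] := X'in u (mem_enum _ _) w.
  rewrite (partition_big g xpredT)//=; apply: eq_bigr => u _.
  have [_ <-] := X'in u (mem_enum _ _) w.
  apply: eq_bigl => i; rewrite andbC; have [<-//|//] := eqVneq (g i) u.
elim: (enum G) (enum_uniq G) => [_|u L IH /= /andP[uL /IH{IH}[X1 [hX1 X1in X1out]]]].
  by exists X; split.
have [X2 [hX2 X2a X2out X2sq]] := helmert_rotation hX1 (ual u).
have X1u i : g i = u -> X1 i = X i by move=> giu; rewrite X1out// giu.
exists X2; split => //; last first.
  move=> i; rewrite inE negb_or => /andP[iu iL].
  by rewrite X2out ?X1out// mem_al.
move=> v; rewrite inE => /predU1P[-> w|vL w].
  have sumE : \sum_(i | g i == u) X1 i w = \sum_(i | g i == u) X i w.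
    by apply: eq_bigr => i /eqP/X1u ->.
  split; first by rewrite X2a sum_al size_al sumE.
  rewrite -sum_l X2sq X2a !sum_al size_al sumE expr_div_n sqr_sqrtr ?ltW//.
  by congr (_ - _); apply: eq_bigr => i /eqP/X1u ->.
have vu : v != u by apply: contraNneq uL => <-.
have X21 i : g i = v -> X2 i = X1 i.
  by move=> giv; rewrite X2out// mem_al giv.
have [<- <-] := X1in v vL w; rewrite X21//; split => //.
by apply: eq_bigr => i /andP[/eqP/X21 ->].
Qed.

End groups.

End helmert.

(** * Determination of the law of a family by its marginals *)

Section normal_scaling.
Context {R : realType}.
Local Notation leb := (@lebesgue_measure R).
Local Open Scope ereal_scope.

(** The density of N(0, sigma^2) is z |-> phi (z / sigma) / sigma, so this is the
substitution z = sigma x. *)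
Lemma normal_prob_scale (sigma : R) (B : set R) : (0 < sigma)%R ->
  measurable B ->
  normal_prob 0 sigma ((fun z : R => z / sigma)%R @^-1` B) = normal_prob 0 1 B.
Proof.
move=> s0 mB.
have pdf_scale z : (normal_pdf 0 sigma z =
    sigma^-1 * normal_pdf 0 1 (sigma^-1 * z + 0))%R.
  rewrite !normal_pdfE ?oner_eq0 ?gt_eqF// /normal_fun !subr0 addr0.
  rewrite mulrA; congr (_ * expR _)%R.
    rewrite /normal_peak expr1n mul1r -mulrnAr sqrtrM ?sqr_ge0//.
    by rewrite sqrtr_sqr gtr0_norm// invfM.
  by field; rewrite gt_eqF.
pose h (x : R) := (\1_B x * normal_pdf 0 1 x)%:E : \bar R.
have mh : measurable_fun [set: R] h.
  apply/measurable_EFinP; apply: measurable_funM => //.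
  exact: measurable_normal_pdf.
have h0 x : 0 <= h x by rewrite lee_fin mulr_ge0// normal_pdf_ge0.
have mhs : measurable_fun [set: R] (fun x => h (sigma^-1 * x + 0)%R).
  apply: (measurableT_comp mh).
  by apply: measurable_funD => //; apply: measurable_funM.
transitivity (\int[leb]_x h x).
  rewrite -(@integral_affine _ sigma^-1%R 0%R h) ?invr_gt0//.
  rewrite -ge0_integralZl//; last by rewrite lee_fin invr_ge0 ltW.
  rewrite /normal_prob [LHS]integral_mkcond; apply: eq_integral => z _.
  rewrite patchE pdf_scale /h -EFinM mulrCA indicE addr0 mulrC.
  have -> : (z \in (fun z0 : R => (z0 / sigma)%R) @^-1` B) = ((z / sigma)%R \in B).
    by apply/idP/idP; rewrite !inE.
  by rewrite (mulrC z); case: (_ \in B); rewrite ?mul1r ?mul0r.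
rewrite /normal_prob [RHS]integral_mkcond; apply: eq_integral => x _.
by rewrite /h patchE indicE; case: (x \in B); rewrite ?mul1r ?mul0r.
Qed.

End normal_scaling.

Section law_of_family.
Context {R : realType} (I : finType).

Definition rectangles : set (set (I -> R)) :=
  [set \bigcap_(i in [set: I]) [set x : I -> R | B i (x i)] |
    B in [set B : I -> set R | forall i, measurable (B i)]].

(** The functions on I with the product sigma-algebra. *)
Definition sample_space := g_sigma_algebraType rectangles.

Lemma measurable_coord (i : I) :
  measurable_fun [set: sample_space] (fun x : sample_space => x i).
Proof.
move=> _ A mA; rewrite setTI; apply: sub_sigma_algebra.
exists (fun j => if j == i then A else setT).
  by move=> j /=; case: ifP.
apply/seteqP; split => x /=; first by move=> /(_ i Logic.I); rewrite eqxx.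
by move=> Ax j _; case: eqVneq => [->|].
Qed.

Lemma measurable_family d (T : measurableType d) (X : I -> T -> R) :
  (forall i, measurable_fun [set: T] (X i)) ->
  measurable_fun [set: T] (fun w => (X^~ w : sample_space)).
Proof.
move=> mX; apply: (@measurability _ _ T sample_space setT (fun w => X^~ w) rectangles erefl).
move=> _ [_ [B mB <-] <-]; rewrite setTI.
rewrite preimage_bigcap; apply: fin_bigcap_measurable => // i _.
by rewrite -[X in measurable X]setTI; exact: mX.
Qed.

(** Rectangles are stable under intersection and generate the product
sigma-algebra, so a law is determined by independence and by the marginals.
This compares experiments governed by different probability measures. *)
Lemma std_normal_family_law d d' (T : measurableType d) (T' : measurableType d')
    (Q : probability T R) (Q' : probability T' R) (X : I -> T -> R)
    (X' : I -> T' -> R) (Phi : set sample_space) :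
  std_normal_family Q X -> std_normal_family Q' X' -> measurable Phi ->
  Q [set w | Phi (X^~ w)] = Q' [set w | Phi (X'^~ w)].
Proof.
move=> [mX XE] [mX' XE'].
pose m1 := image_measure Q (measurable_family mX).
pose m2 := image_measure Q' (measurable_family mX').
have rectT : rectangles [set: sample_space].
  by exists (fun=> setT) => //; apply/seteqP; split.
apply: (@measure_unique _ R sample_space rectangles (fun=> setT) _ _ _ _ m1 m2) => //.
- move=> _ _ [A mA <-] [B mB <-]; exists (fun i => A i `&` B i).
    by move=> i; apply: measurableI.
  rewrite bigcapI//.
- by rewrite bigcup_const.
- by move=> _ [B mB <-]; exact: etrans (XE B mB) (esym (XE' B mB)).
- by move=> _; rewrite /m1 /= /pushforward preimage_setT probability_setT ltry.
Qed.

End law_of_family.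

(** * The min-max form of the estimators *)

Section sdmmsa_minmax.
Context {R : realType} {k : nat} (n : 'I_k.+1 -> nat).
Hypothesis hn : forall i, (1 <= n i)%N.
Variable y : forall i, 'I_(n i) -> R.
Implicit Types (i j s t r : nat) (x : R).

(** The sign of this sum compares the pooled mean with x, and unlike pooled means
it is additive over adjacent ranges. *)
Definition excess x i j : R :=
  \sum_(h < k.+1 | (i <= h <= j)%N) (n h)%:R * (sample_mean y h - x).

Lemma excessE x i j : (i <= j <= k)%N ->
  exists2 w : R, 0 < w & excess x i j = w * (pooled_mean y i j - x).
Proof.
move=> /andP[ij jk].
exists (\sum_(h < k.+1 | (i <= h <= j)%N) n h)%:R.
  rewrite ltr0n (bigD1 (Ordinal (jk : j < k.+1)%N))/= ?ij ?leqnn//.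
  by rewrite addn_gt0 hn.
rewrite mulrBr /pooled_mean mulrC divfK; last first.
  rewrite pnatr_eq0 -lt0n (bigD1 (Ordinal (jk : j < k.+1)%N))/= ?ij ?leqnn//.
  by rewrite addn_gt0 hn.
rewrite natr_sum mulr_suml -sumrB.
by apply: eq_bigr => h _; rewrite mulrBr.
Qed.

Lemma excess_gt0 x i j : (i <= j <= k)%N ->
  (0 < excess x i j) = (x < pooled_mean y i j).
Proof. by move=> /(excessE x)[w w0 ->]; rewrite pmulr_rgt0// subr_gt0. Qed.

Lemma excess_le0 x i j : (i <= j <= k)%N ->
  (excess x i j <= 0) = (pooled_mean y i j <= x).
Proof. by move=> ijk; rewrite leNgt excess_gt0// -leNgt. Qed.

Lemma excess_ge0 x i j : (i <= j <= k)%N ->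
  (0 <= excess x i j) = (x <= pooled_mean y i j).
Proof. by move=> /(excessE x)[w w0 ->]; rewrite pmulr_rge0// subr_ge0. Qed.

Lemma excess_pooled i j : (i <= j <= k)%N -> excess (pooled_mean y i j) i j = 0.
Proof. by move=> /excessE-/(_ (pooled_mean y i j))[w _ ->]; rewrite subrr mulr0. Qed.

Lemma excess_cat x i m j : (i <= m.+1)%N -> (m <= j)%N ->
  excess x i j = excess x i m + excess x m.+1 j.
Proof.
move=> im mj; rewrite /excess [LHS](bigID (fun h : 'I_k.+1 => h <= m)%N)/=.
by congr (_ + _); apply: eq_bigl => h; lia.
Qed.

Lemma excess_decr x x' i j : x <= x' -> excess x' i j <= excess x i j.
Proof.
by move=> xx'; apply: ler_sum => h _; rewrite ler_wpM2l// lerD2l lerN2.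
Qed.

Lemma block_startP r : (1 <= r)%N ->
  (1 <= block_start y r <= r)%N /\
  forall s, (1 <= s <= r)%N -> pooled_mean y s r <= pooled_mean y (block_start y r) r.
Proof.
case: r => // r _; rewrite /block_start; set F := [seq j <- _ | _].
have mem_range s : (s \in index_iota 1 r.+2) = (1 <= s <= r.+1)%N.
  by rewrite mem_index_iota.
have [j jmax] : exists j : 'I_r.+1, forall i : 'I_r.+1,
    pooled_mean y i.+1 r.+1 <= pooled_mean y j.+1 r.+1.
  case: (@Order.TotalTheory.arg_maxP _ _ _ (ord0 : 'I_r.+1) predT
    (fun i : 'I_r.+1 => pooled_mean y i.+1 r.+1)) => // j _ jmax.
  by exists j => i; exact: jmax.
have jF : j.+1 \in F.
  rewrite mem_filter mem_range ltnS leq0n (ltn_ord j) !andbT; apply/allP => s.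
  rewrite mem_range => /andP[s1 sr].
  have sr' : (s.-1 < r.+1)%N by rewrite prednK.
  by have := jmax (Ordinal sr'); rewrite /= prednK.
have : head 1%N F \in F by case: F jF => // a F' _; exact: mem_head.
rewrite mem_filter mem_range => /andP[/allP maxF ->]; split => // s.
by rewrite -mem_range; exact: maxF.
Qed.

Lemma breakpointS u : breakpoint y u.+1 = block_start y (breakpoint y u).-1.
Proof. by []. Qed.

Lemma breakpoint_ge1 u : (1 <= breakpoint y u)%N.
Proof.
case: u => [|u]; first by [].
rewrite breakpointS; have [->|r1] := posnP (breakpoint y u).-1.
  by [].
by have [/andP[]] := block_startP r1.
Qed.

Lemma breakpoint_le u : (breakpoint y u <= maxn 1 (k.+1 - u))%N.
Proof.
elim: u => [|u IH]; first by rewrite subn0 leq_max leqnn orbT.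
rewrite breakpointS; have [->|r1] := posnP (breakpoint y u).-1.
  by rewrite leq_max.
have [/andP[_ le] _] := block_startP r1.
lia.
Qed.

(** The excess over the block vanishes at the pooled mean v of the block, and any
final segment of the block has pooled mean at most v by the choice of the block
start; hence the excess of any initial segment is nonnegative. *)
Lemma block_excess_ge0 r t : (1 <= r <= k)%N -> (block_start y r <= t <= r)%N ->
  0 <= excess (pooled_mean y (block_start y r) r) (block_start y r) t.
Proof.
move=> /andP[r1 rk] /andP[st tr].
have [/andP[s1 sr] smax] := block_startP r1.
set s := block_start y r in st s1 sr smax *; set v := pooled_mean y s r.
have sv : excess v s r = 0 by rewrite excess_pooled ?sr.
have [->|ltr] := eqVneq t r; first by rewrite sv.
have le_tail : excess v t.+1 r <= 0.
  rewrite excess_le0; last by rewrite rk andbT ltn_neqAle ltr.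
  by apply: smax; rewrite /= ltn_neqAle ltr.
by move: sv; rewrite (@excess_cat v s t r) ?(leqW st)//; lra.
Qed.

(** An initial segment that starts at a breakpoint and passes beyond its block
splits into that block, whose excess is 0, and an initial segment starting at
the previous breakpoint.  The latter has nonnegative excess at its own block
value, hence at any smaller one, and block values decrease from right to
left. *)
Lemma breakpoint_excess u t : (1 < breakpoint y u)%N ->
  (breakpoint y u.+1 <= t <= k)%N ->
  0 <= excess (pooled_mean y (breakpoint y u.+1) (breakpoint y u).-1)
    (breakpoint y u.+1) t.
Proof.
have bk v : (breakpoint y v <= k.+1)%N.
  by have := breakpoint_le v; have := breakpoint_ge1 v; lia.
elim: u t => [|u IH] t bu /andP[bt tk].
  by apply: block_excess_ge0; [have := bk 0%N; lia|rewrite bt].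
have bu' : (1 < breakpoint y u)%N.
  rewrite ltnNge; apply/negP => b1; move: bu; rewrite breakpointS.
  by have -> : (breakpoint y u).-1 = 0%N by lia.
have /block_startP[] : (1 <= (breakpoint y u).-1)%N by lia.
rewrite -breakpointS => /andP[_ re] emax.
set r := breakpoint y u.+1 in bu re emax IH *.
set e := (breakpoint y u).-1 in re emax IH.
have ek : (e <= k)%N by have := bk u; rewrite /e; lia.
have r1 : (1 <= r.-1)%N by lia.
have [/andP[s1 sr] _] := block_startP r1.
rewrite breakpointS -/r in bt *; set s := block_start y r.-1 in bt s1 sr *.
set v := pooled_mean y s r.-1.
have [tr|rt] := leqP t r.-1.
  by apply: block_excess_ge0; rewrite ?bt//; lia.
have v_le : v <= pooled_mean y r e.
  have /emax : (1 <= s <= e)%N by lia.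
  move=> le_e; rewrite leNgt; apply/negP => lt_v; move: le_e; apply/negP; rewrite -ltNge -excess_gt0; last by lia.
  rewrite (@excess_cat _ s r.-1 e); [|lia|lia].
  rewrite prednK ?excess_pooled ?addr0 ?excess_gt0//; lia.
have := @excess_cat v s r.-1 t; rewrite excess_pooled; last by lia.
rewrite add0r prednK; last by lia.
move=> ->; [|lia|lia].
by apply: le_trans (excess_decr _ _ v_le); apply: IH => //; lia.
Qed.

(** The estimator is the isotonic regression
  mu^_j = min_(t >= j) max_(s <= j) pooled_mean s t,
written as a criterion for x < mu^_j.  For the direct implication take s to be
the start of the block of j, whose excesses at the block value are nonnegative;
for the converse take t to be the end of that block, over which the block start
maximizes the pooled mean. *)
Lemma sdmmsa_minmax x j : (1 <= j <= k)%N ->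
  x < sdmmsa y j <->
  forall t, (j <= t <= k)%N ->
    exists2 s, (1 <= s <= j)%N & x < pooled_mean y s t.
Proof.
move=> /andP[j1 jk].
rewrite /sdmmsa; set u := find _ _.
have has_u : has (fun v => breakpoint y v <= j)%N (iota 0 k.+1).
  apply/hasP; exists k; first by rewrite mem_iota leq0n add0n leqnn.
  by apply: leq_trans (breakpoint_le k) _; lia.
have uk : (u < k.+1)%N by rewrite -[X in (_ < X)%N](size_iota 0) -has_find.
have bu : (breakpoint y u <= j)%N.
  by have := nth_find 0%N has_u; rewrite nth_iota.
have bv v : (v < u)%N -> (j < breakpoint y v)%N.
  move=> vu; have := before_find 0%N vu.
  by rewrite nth_iota ?(ltn_trans vu)// add0n => /negbT; rewrite -ltnNge.
have u0 : (0 < u)%N by rewrite lt0n; apply/eqP => u0; move: bu; rewrite u0/=; lia.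
have bkv : (breakpoint y u.-1 <= k.+1)%N.
  by have := breakpoint_le u.-1; have := breakpoint_ge1 u.-1; lia.
have jb : (j < breakpoint y u.-1)%N by apply: bv; rewrite prednK.
have bu1 := breakpoint_ge1 u.
split=> [xv t /andP[jt tk]|/(_ (breakpoint y u.-1).-1)[|s sj xs]].
- exists (breakpoint y u); first by rewrite bu1.
  apply: lt_le_trans xv _; rewrite -excess_ge0; last by lia.
  by have := @breakpoint_excess u.-1 t; rewrite prednK//; apply; lia.
- by lia.
- apply: lt_le_trans xs _.
  have e1 : (1 <= (breakpoint y u.-1).-1)%N by lia.
  have [_ smax] := block_startP e1.
  by rewrite -[in leRHS](prednK u0) breakpointS; apply: smax; lia.
Qed.

End sdmmsa_minmax.

(** * Student's law for the difference of two group means *)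

Section one_way_sample.
Context {R : realType} {k : nat} (n : 'I_k.+1 -> nat).
Hypothesis hn : forall i, (1 <= n i)%N.
Local Notation I := {i : 'I_k.+1 & 'I_(n i)}.

(** Curries the errors, which are indexed by the pairs (group, rank), into the
format of a data set. *)
Definition arrange (x : I -> R) : forall i, 'I_(n i) -> R :=
  fun i j => x (Tagged (fun i => 'I_(n i)) j).

Lemma sum_group (V : nmodType) (F : I -> V) (u : 'I_k.+1) :
  \sum_(i | tag i == u) F i = \sum_(j < n u) F (Tagged (fun i => 'I_(n i)) j).
Proof.
transitivity (\sum_(i | i == u) \sum_(j < n i) F (Tagged (fun i => 'I_(n i)) j)).
  rewrite (sig_big_dep (fun i => i == u) (fun _ _ => true)
    (fun i j => F (Tagged (fun i => 'I_(n i)) j))) /=.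
  by apply: eq_big => [i|[i j] _ //]; rewrite andbT.
by rewrite big_pred1_eq.
Qed.

Lemma card_group (u : 'I_k.+1) : #|[pred i : I | tag i == u]| = n u.
Proof. by rewrite -sum1_card (sum_group (fun=> 1%N)) sum1_card card_ord. Qed.

Lemma sum_group_mean (x : I -> R) u :
  \sum_(i | tag i == u) x i = (n u)%:R * sample_mean (arrange x) u.
Proof.
rewrite sum_group /sample_mean mulrC divfK//.
by rewrite pnatr_eq0 -lt0n.
Qed.

Lemma sum_group_squares (x : I -> R) u :
  \sum_(i | tag i == u) x i ^+ 2 - (\sum_(i | tag i == u) x i) ^+ 2 / (n u)%:R =
  \sum_(j < n u) (arrange x j - sample_mean (arrange x) u) ^+ 2.
Proof.
have nu0 : (n u)%:R != 0 :> R by rewrite pnatr_eq0 -lt0n.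
rewrite sum_group_mean; set m := sample_mean _ u.
rewrite [RHS](eq_bigr (fun j : 'I_(n u) =>
  (arrange x j ^+ 2 - m * arrange x j *+ 2) + m ^+ 2)); last first.
  by move=> j _; rewrite sqrrB (mulrC m).
rewrite big_split/= sumrB sumr_const card_ord sumrMnl -mulr_sumr.
have -> : \sum_(j < n u) arrange x j = (n u)%:R * m.
  by rewrite -sum_group_mean sum_group.
rewrite (sum_group (fun i => x i ^+ 2)) -/(arrange x) -(mulr_natl (m ^+ 2)) -addrA.
congr (_ + _); rewrite -(mulr_natl (m * _)); field; exact: nu0.
Qed.

(** The coordinate of the group that receives its normalized sum under Helmert's
transformation; the remaining ones carry the residual sum of squares. *)
Definition group_head (u : 'I_k.+1) : I :=
  Tagged (fun i => 'I_(n i)) (Ordinal (hn u)).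

(** One coordinate is lost per group: the residual degrees of freedom. *)
Lemma size_residual_index :
  size [seq i : I <- enum {: I} | i != group_head (tag i)] = error_df n.
Proof.
rewrite -sum1_size big_filter big_enum_cond/= /error_df.
have : (\sum_(i : I) 1 = \sum_(u < k.+1) n u)%N.
  rewrite (partition_big tag xpredT)//=; apply: eq_bigr => u _.
  by rewrite sum1_card card_group.
rewrite (bigID (fun i : I => i != group_head (tag i)))/= => <-.
rewrite [X in (_ = _ + X - _)%N](_ : _ = k.+1) ?addnK//.
rewrite (partition_big tag xpredT)//= -[RHS]card_ord -sum1_card.
apply: eq_bigr => u _; rewrite (big_pred1 (group_head u))// => i /=.
rewrite negbK; by apply/andP/eqP => [[/eqP iE /eqP <-]|->]; rewrite ?eqxx.
Qed.

End one_way_sample.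

Section two_sample_student.
Context {R : realType} {k : nat} (n : 'I_k.+1 -> nat).
Hypothesis hn : forall i, (1 <= n i)%N.
Local Notation I := {i : 'I_k.+1 & 'I_(n i)}.

(** After Helmert's transformation in every group, the normalized sums and the
residual coordinates are independent standard normals, and the residual
coordinates have sum of squares equal to the error sum of squares.  One more
rotation, in the plane of the heads of the groups u and v, produces the
standardized difference of the two means, still independent of the residuals. *)
Lemma two_sample_student d (T : measurableType d) (Q : probability T R)
    (X : I -> T -> R) (u v : 'I_k.+1) (t : R) :
  std_normal_family Q X -> u != v ->
  Q [set w | t * Num.sqrt ((n u)%:R^-1 + (n v)%:R^-1) <
      (sample_mean (arrange (X^~ w)) u - sample_mean (arrange (X^~ w)) v)
        / root_mse (arrange (X^~ w))] =
  student_prob (error_df n) `]t, +oo[%classic.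
Proof.
move=> hX uv.
have ga : cancel (group_head hn) tag by [].
have [X1 [hX1 X1head X1sq]] := helmert_groups ga hX.
set h := group_head hn in ga X1head X1sq.
have huv : h u != h v by rewrite (inj_eq (can_inj ga)).
have nu0 i : 0 < (n i)%:R :> R by rewrite ltr0n.
have snu0 i : 0 < Num.sqrt (n i)%:R :> R by rewrite sqrtr_gt0.
pose D2 : R := (n u)%:R^-1 + (n v)%:R^-1.
have D20 : 0 < D2 by rewrite addr_gt0// invr_gt0.
have D0 : 0 < Num.sqrt D2 by rewrite sqrtr_gt0.
(* X1 (h i) is sqrt (n i) times the mean of group i, so these coefficients give
   the difference of the means over its standard deviation. *)
pose c := (Num.sqrt (n u)%:R)^-1 / Num.sqrt D2.
pose s := (Num.sqrt (n v)%:R)^-1 / Num.sqrt D2.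
have cs : c ^+ 2 + s ^+ 2 = 1.
  rewrite /c /s !expr_div_n !exprVn !sqr_sqrtr ?ltW// -mulrDl.
  by rewrite divff// gt_eqF.
have c0 : 0 < c by rewrite divr_gt0// invr_gt0.
have hX2 := std_normal_family_rotate hX1 huv c0 cs.
set X2 := rotate_pair _ _ _ _ _ in hX2.
pose t2 := [seq i : I <- enum {: I} | i != h (tag i)].
have X1mean i w : X1 (h i) w = Num.sqrt (n i)%:R * sample_mean (arrange (X^~ w)) i.
  rewrite X1head sum_group_mean// card_group -{1}(sqr_sqrtr (ltW (nu0 i))).
  by field; rewrite gt_eqF.
have X2u w : X2 (h u) w =
    (sample_mean (arrange (X^~ w)) u - sample_mean (arrange (X^~ w)) v) / Num.sqrt D2.
  rewrite /X2 /rotate_pair eqxx !X1mean /c /s; field.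
  by rewrite !gt_eqF.
have X2sq w : \sum_(i <- t2) X2 i w ^+ 2 = \sum_(i < k.+1) \sum_(j < n i)
    (arrange (X^~ w) j - sample_mean (arrange (X^~ w)) i) ^+ 2.
  transitivity (\sum_(i : I | i != h (tag i)) X1 i w ^+ 2).
    rewrite big_filter big_enum_cond; apply: eq_bigr => i ih.
    rewrite /X2 /rotate_pair; case: eqVneq => [iu|_].
      by move: ih; rewrite iu ga eqxx.
    by case: eqVneq => [iv|//]; move: ih; rewrite iv ga eqxx.
  rewrite X1sq; apply: eq_bigr => i _.
  by rewrite card_group -sum_group_squares.
pose f := fun zv : R * R => zv.1 / Num.sqrt (zv.2 / (error_df n)%:R).
have mf : measurable_fun [set: (R * R)%type] f.
  apply: measurable_funM => //; apply: (measurableT_comp (@measurable_invr R)).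
  apply: (measurableT_comp (@measurable_sqrtr R)).
  by apply: measurable_funM.
have mC : measurable (f @^-1` `]t, +oo[%classic).
  by rewrite -[X in measurable X]setTI; exact: mf.
have ht2 : h u \notin t2 by rewrite mem_filter ga eqxx.
have ut2 : uniq t2 by rewrite filter_uniq// enum_uniq.
have law : Q ((fun w => (X2 (h u) w, \sum_(i <- t2) X2 i w ^+ 2)) @^-1`
      (f @^-1` `]t, +oo[%classic)) = student_prob (error_df n) `]t, +oo[%classic.
  have /(_ _ mC) := normal_chi2_law hX2 ht2 ut2.
  by rewrite [size t2](size_residual_index hn).
have scale_lt A S : (t * Num.sqrt D2 < A / S) = (t < A / Num.sqrt D2 / S).
  by rewrite (mulrAC A) [RHS]ltr_pdivlMr.
rewrite -law; congr (Q _); apply/seteqP.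
by split => w /=; rewrite in_itv/= andbT /f/= X2u X2sq scale_lt.
Qed.

End two_sample_student.

(** * The rejection region in terms of standardized errors *)

Lemma measurable_sum_cond d (T : measurableType d) (R : realType) (J : Type)
    (r : seq J) (p : pred J) (h : J -> T -> R) :
  (forall j, measurable_fun [set: T] (h j)) ->
  measurable_fun [set: T] (fun x => \sum_(j <- r | p j) h j x).
Proof.
by move=> mh; under eq_fun do rewrite -big_filter; exact: measurable_sum.
Qed.

Section standardized_rejection.
Context {R : realType} {k : nat} (n : 'I_k.+1 -> nat).
Hypothesis hn : forall i, (1 <= n i)%N.
Local Notation I := {i : 'I_k.+1 & 'I_(n i)}.
Implicit Types (m : 'I_k.+1 -> R) (x : I -> R) (c : nat -> R).

Definition weighted_mean (f : 'I_k.+1 -> R) (s t : nat) : R :=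
  (\sum_(h < k.+1 | (s <= h <= t)%N) (n h)%:R * f h)
  / (\sum_(h < k.+1 | (s <= h <= t)%N) n h)%:R.

Lemma weighted_mean_affine (f : 'I_k.+1 -> R) a b s t : (s <= t <= k)%N ->
  weighted_mean (fun h => a * f h + b) s t = a * weighted_mean f s t + b.
Proof.
move=> /andP[st tk]; rewrite /weighted_mean.
have W0 : (\sum_(h < k.+1 | (s <= h <= t)%N) n h)%:R != 0 :> R.
  rewrite pnatr_eq0 -lt0n (bigD1 (Ordinal (tk : t < k.+1)%N))/= ?st ?leqnn//.
  by rewrite addn_gt0 hn.
rewrite mulrA -[b in RHS](mulfK W0) -mulrDl; congr (_ / _).
rewrite natr_sum !mulr_sumr -big_split/=.
by apply: eq_bigr => h _; ring.
Qed.

Lemma weighted_mean_le (f f' : 'I_k.+1 -> R) s t :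
  (forall h : 'I_k.+1, (s <= h)%N -> f h <= f' h) ->
  weighted_mean f s t <= weighted_mean f' s t.
Proof.
move=> ff'; rewrite ler_wpM2r// ler_sum// => h /andP[sh _].
by rewrite ler_wpM2l// ff'.
Qed.

(** Also true for S = 0, where division by S returns 0 and both sides reduce to
x < 0. *)
Lemma ltr_sdmmsa_ratio (y : forall i, 'I_(n i) -> R) (b S x : R) (j : nat) :
  0 <= S -> (1 <= j <= k)%N ->
  x < (sdmmsa y j - b) / S <->
  forall t, (j <= t <= k)%N ->
    exists2 s, (1 <= s <= j)%N & x < (pooled_mean y s t - b) / S.
Proof.
move=> S0 jk; have [j1 jk'] := andP jk.
have [->|Sneq0] := eqVneq S 0.
  rewrite invr0 mulr0; split=> [x0 t _|/(_ j)[|s _]].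
  - by exists j; rewrite ?mulr0 ?j1/=.
  - by rewrite leqnn.
  - by rewrite mulr0.
have Sgt0 : 0 < S by rewrite lt_neqAle eq_sym Sneq0.
have H v : (x < (v - b) / S) = (x * S + b < v).
  by rewrite ltr_pdivlMr// ltrBrDr.
rewrite H (sdmmsa_minmax hn)//; split=> E t /E[s sj];
  by rewrite ?H => ?; exists s; rewrite ?H.
Qed.

Variable delta : R.

(** For the data y = m + sigma x this is
(mean of group h - mean of group 0 - delta) / sigma.  The parameters only enter
through a shift. *)
Definition standardized_gap m (sigma : R) x (h : 'I_k.+1) : R :=
  sample_mean (arrange x) h - sample_mean (arrange x) ord0
  + (m h - m ord0 - delta) / sigma.

(** The rejection region read on the standardized errors x, with the estimators
replaced by their min-max form.  It is visibly monotone in the gaps, and it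
depends on the parameters only through them. *)
Definition standardized_rejection c (q : nat) m sigma : set (I -> R) :=
  [set x | exists2 j, (1 <= j <= q)%N &
    forall t, (j <= t <= k)%N -> exists2 s, (1 <= s <= j)%N &
      c j < weighted_mean (standardized_gap m sigma x) s t
            / root_mse (arrange x)].

Lemma standardized_rejection_mono c q m m' (sigma sigma' : R) :
  (forall h : 'I_k.+1, (1 <= h)%N ->
     (m h - m ord0 - delta) / sigma <= (m' h - m' ord0 - delta) / sigma') ->
  standardized_rejection c q m sigma `<=` standardized_rejection c q m' sigma'.
Proof.
move=> mm' x [j jq rej]; exists j => // t /rej[s sj cj].
exists s => //; apply: lt_le_trans cj _; apply: ler_wpM2r.
  by rewrite invr_ge0 sqrtr_ge0.
apply: weighted_mean_le => h sh; rewrite lerD2l mm'//.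
by apply: leq_trans sh; case/andP: sj.
Qed.

Lemma standardized_rejectionE c q m sigma (y : forall i, 'I_(n i) -> R) x :
  0 < sigma -> (q <= k)%N ->
  (forall i (j : 'I_(n i)), y i j = m i + sigma * arrange x j) ->
  (exists2 j, (1 <= j <= q)%N &
    c j < (sdmmsa y j - sample_mean y ord0 - delta) / root_mse y) <->
  standardized_rejection c q m sigma x.
Proof.
move=> s0 qk yE.
have nu0 i : (n i)%:R != 0 :> R by rewrite pnatr_eq0 -lt0n.
have meanE i : sample_mean y i = m i + sigma * sample_mean (arrange x) i.
  rewrite /sample_mean (eq_bigr _ (fun j _ => yE i j)) big_split/= -mulr_sumr.
  rewrite sumr_const card_ord -mulr_natr; field; exact: nu0.
have mseE : root_mse y = sigma * root_mse (arrange x).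
  rewrite /root_mse -[X in _ = X * _](gtr0_norm s0) -sqrtr_sqr -sqrtrM ?sqr_ge0//.
  congr Num.sqrt; rewrite mulrA mulr_sumr; congr (_ / _).
  apply: eq_bigr => i _; rewrite mulr_sumr; apply: eq_bigr => j _.
  by rewrite meanE yE; ring.
have gapE s t : (s <= t <= k)%N ->
    (pooled_mean y s t - (sample_mean y ord0 + delta)) / root_mse y =
    weighted_mean (standardized_gap m sigma x) s t / root_mse (arrange x).
  move=> stk; rewrite mseE invfM mulrA; congr (_ / _).
  rewrite -[pooled_mean y s t]/(weighted_mean (sample_mean y) s t).
  rewrite mulrC mulrBr -mulrN -weighted_mean_affine//.
  rewrite /weighted_mean; congr (_ / _); apply: eq_bigr => h _; congr (_ * _).
  rewrite !meanE /standardized_gap; field; rewrite gt_eqF//.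
by split=> -[j jq] rej; exists j => //; move: rej;
  rewrite -addrA -opprD ltr_sdmmsa_ratio ?sqrtr_ge0//; try lia;
  move=> rej t jt; have [s sj] := rej t jt; rewrite ?gapE; try lia;
  move=> cj; exists s; rewrite ?gapE//; lia.
Qed.

Lemma measurable_sample_mean (h : 'I_k.+1) :
  measurable_fun [set: @sample_space R I]
    (fun x : @sample_space R I => sample_mean (arrange x) h).
Proof.
apply: measurable_funM => //; apply: measurable_sum => j.
exact: measurable_coord.
Qed.

Lemma measurable_root_mse :
  measurable_fun [set: @sample_space R I]
    (fun x : @sample_space R I => root_mse (arrange x)).
Proof.
have mss : measurable_fun [set: @sample_space R I] (fun x : @sample_space R I =>
    (\sum_(i < k.+1) \sum_(j < n i)
      (arrange x j - sample_mean (arrange x) i) ^+ 2) / (error_df n)%:R).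
  apply: measurable_funM => //.
  apply: measurable_sum => i; apply: measurable_sum => j.
  apply: measurable_funX; apply: measurable_funB; last exact: measurable_sample_mean.
  exact: measurable_coord.
exact: (measurableT_comp (@measurable_sqrtr R) mss).
Qed.

Lemma measurable_standardized_rejection c q m sigma :
  measurable (standardized_rejection c q m sigma : set (@sample_space R I)).
Proof.
have mmean := measurable_sample_mean; have mmse := measurable_root_mse.
have mstat s t : measurable_fun [set: @sample_space R I] (fun x : @sample_space R I =>
    weighted_mean (standardized_gap m sigma x) s t / root_mse (arrange x)).
  apply: measurable_funM; last exact: (measurableT_comp (@measurable_invr R)).
  apply: measurable_funM => //.
  apply: measurable_sum_cond => h.
  apply: measurable_funM => //; apply: measurable_funD => //.
  exact: measurable_funB.
rewrite (_ : standardized_rejection c q m sigma =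
  \bigcup_(j in [set j | (1 <= j <= q)%N])
  \bigcap_(t in [set t | (j <= t <= k)%N])
  \bigcup_(s in [set s | (1 <= s <= j)%N])
   [set x : @sample_space R I | c j < weighted_mean (standardized_gap m sigma x) s t
            / root_mse (arrange x)]); last first.
  by apply/seteqP; split => x [j jq rej]; exists j => // t /rej[s sj cj]; exists s.
apply: bigcup_measurable => j _; apply: bigcap_measurableType => t _.
apply: bigcup_measurable => s _.
rewrite (_ : [set x | _] = (fun x : @sample_space R I =>
    weighted_mean (standardized_gap m sigma x) s t / root_mse (arrange x))
    @^-1` `]c j, +oo[%classic); last first.
  by apply/seteqP; split => x /=; rewrite in_itv/= andbT.
by rewrite -[X in measurable X]setTI; exact: mstat.
Qed.

End standardized_rejection.

(** * The experimentwise error rate *)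

Section experiment.
Context {R : realType} {k : nat} (n : 'I_k.+1 -> nat).
Hypothesis hn : forall i, (1 <= n i)%N.
Context {d : measure_display} {T : measurableType d}.
Variable Y : forall i, 'I_(n i) -> {mfun T >-> R}.
Variable P : ('I_k.+1 -> R) -> R -> probability T R.
Hypothesis hmodel : normal_one_way_model Y P.
Local Notation I := {i : 'I_k.+1 & 'I_(n i)}.

Definition standardized_error mu (sigma : R) (s : I) (w : T) : R :=
  error Y mu s w / sigma.

Lemma std_normal_family_error mu sigma : mu \in param_space -> 0 < sigma ->
  std_normal_family (P mu sigma) (standardized_error mu sigma).
Proof.
move=> hmu s0; have [indep law] := hmodel hmu s0; split=> [s|B mB].
  by apply: measurable_funM => //; apply: measurable_funB.
have mscale (A : set R) : measurable A ->
    measurable ((fun z : R => z / sigma) @^-1` A).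
  move=> mA; rewrite -[X in measurable X]setTI.
  by have /(_ measurableT A mA) : measurable_fun [set: R] (fun z : R => z / sigma)
    by apply: measurable_funM.
rewrite -[LHS]/(P mu sigma (\bigcap_(s in [set: I])
  error Y mu s @^-1` ((fun z : R => z / sigma) @^-1` B s))).
rewrite indep; last by move=> s; exact: mscale.
apply: eq_bigr => s _; rewrite law; last exact: mscale.
by rewrite normal_prob_scale.
Qed.

Lemma rejection_regionE delta c q mu sigma : 0 < sigma -> (q <= k)%N ->
  rejection_region Y delta c q =
  [set w | standardized_rejection delta c q mu sigma
    ((standardized_error mu sigma)^~ w)].
Proof.
move=> s0 qk; apply/seteqP.
have yE w i (j : 'I_(n i)) : data Y w j =
    mu i + sigma * arrange ((standardized_error mu sigma)^~ w) j.
  rewrite /arrange /standardized_error /error /data /=; field.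
  by rewrite gt_eqF.
have E w := standardized_rejectionE hn delta c s0 qk (yE w).
split=> w; last by move=> /= /E[j jq cj]; exists j.
by move=> [j jq cj]; apply/E; exists j.
Qed.

Lemma measurable_standardized_error_event mu sigma (Phi : set (@sample_space R I)) :
  measurable Phi ->
  measurable [set w | Phi ((standardized_error mu sigma)^~ w)].
Proof.
move=> mPhi; rewrite -[X in measurable X]setTI.
apply: (@measurable_family R I _ T (standardized_error mu sigma)) => // s.
by apply: measurable_funM => //; apply: measurable_funB.
Qed.

Lemma measurable_rejection_region delta c q : (q <= k)%N ->
  measurable (rejection_region Y delta c q).
Proof.
move=> qk; rewrite (@rejection_regionE delta c q (fun=> 0) 1)//.
by apply: measurable_standardized_error_event; exact: measurable_standardized_rejection.
Qed.

(** A coupling: the standardized errors have the same law under both parameter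
values, and for each value of these errors, rejection under the first parameter
implies rejection under the second. *)
Lemma rejection_prob_mono delta c q mu mu' (sigma sigma' : R) : (q <= k)%N ->
  mu \in param_space -> mu' \in param_space -> 0 < sigma -> 0 < sigma' ->
  (forall h : 'I_k.+1, (1 <= h)%N ->
     (mu h - mu ord0 - delta) / sigma <= (mu' h - mu' ord0 - delta) / sigma') ->
  (P mu sigma (rejection_region Y delta c q) <=
   P mu' sigma' (rejection_region Y delta c q))%E.
Proof.
move=> qk hmu hmu' s0 s'0 mm'.
rewrite [in leLHS](@rejection_regionE delta c q mu sigma)//.
rewrite (std_normal_family_law (std_normal_family_error hmu s0)
  (std_normal_family_error hmu' s'0)); last exact: measurable_standardized_rejection.
apply: le_measure; rewrite ?inE.
- by apply: measurable_standardized_error_event; exact: measurable_standardized_rejection.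
- exact: measurable_rejection_region.
rewrite (@rejection_regionE delta c q mu' sigma')// => w.
exact: standardized_rejection_mono.
Qed.

End experiment.

Theorem theorem6 (R : realType) (k : nat) (hk : (1 <= k)%N)
    (n : 'I_k.+1 -> nat) (hn : forall i, (1 <= n i)%N)
    (hdf : (1 <= error_df n)%N)
    (d : measure_display) (T : measurableType d)
    (Y : forall i, 'I_(n i) -> {mfun T >-> R})
    (P : ('I_k.+1 -> R) -> R -> probability T R)
    (hmodel : normal_one_way_model Y P)
    (delta : R) (hdelta : 0 <= delta)
    (alpha : R) (halpha : 0 < alpha < 1)
    (m0 sigma0 : R) (hsigma0 : 0 < sigma0) (c : nat -> R)
    (hc : critical_constants Y P delta alpha m0 sigma0 c)
    (mu : 'I_k.+1 -> R) (hmu : mu \in param_space)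
    (sigma : R) (hsigma : 0 < sigma) :
  (P mu sigma (incorrect_assertion Y delta c mu) <= alpha%:E)%E.
Proof.
pose true_null := [pred i : 'I_k.+1 | (1 <= i)%N && (mu i - mu ord0 <= delta)].
have nullE (i : 'I_k.+1) : (1 <= i)%N /\ mu \in null_hypothesis delta i <-> true_null i.
  rewrite inE /null_hypothesis /= hmu; split; first by move=> [-> []].
  by move=> /andP[].
have [q0 q0P|no_null] := pickP true_null; last first.
  rewrite (_ : incorrect_assertion _ _ _ _ = set0).
    by rewrite measure0 lee_fin ltW//; case/andP: halpha.
  by rewrite -subset0 => w [i /nullE]; rewrite no_null.
(* The rejection regions increase with their index, so the error event is the one
   of the last true null. *)
pose q := [arg max_(i > q0 | true_null i) (i : nat)].
have [qnull qmax] : true_null q /\ forall i, true_null i -> (i <= q)%N.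
  by rewrite /q; case: arg_maxnP.
have [q1 muq] := andP qnull.
have qk : (q <= k)%N by rewrite -ltnS.
have -> : incorrect_assertion Y delta c mu = rejection_region Y delta c q.
  apply/seteqP; split=> w; last by exists q => //; apply/nullE.
  move=> [i /nullE/qmax iq] [j /andP[j1 ji] cj]; exists j => //=.
  by rewrite j1 (leq_trans ji).
have mu_le (h : 'I_k.+1) : (1 <= h <= q)%N -> mu h - mu ord0 - delta <= 0.
  move=> hq; rewrite subr_le0; apply: le_trans muq; rewrite lerD2r.
  by move: hmu; rewrite inE; apply.
have [t tq c1E] := hc.1.
have [q_gt1|q_le1] := ltnP 1 q.
(* At least two true nulls.  The shifts of the true nulls are nonpositive, and 0 in
   the least favorable configuration; the other shifts are exceeded there as soon
   as the means that tend to infinity pass M.  So the probability at mu is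
   eventually a lower bound of a quantity that tends to alpha. *)
- pose M := m0 + delta + sigma0 *
    \big[Num.max/0]_(h < k.+1) ((mu h - mu ord0 - delta) / sigma).
  have near_ge : \forall mu' \near least_favorable delta m0 q,
      (P mu sigma (rejection_region Y delta c q) <=
       P mu' sigma0 (rejection_region Y delta c q))%E.
    exists M => // mu' [hmu' mu'0 mu'q mu'M].
    apply: rejection_prob_mono => // h h1; rewrite mu'0.
    have [hq|qh] := leqP h q.
      rewrite mu'q ?h1// (addrC m0) addrK subrr mul0r.
      by rewrite pmulr_lle0 ?invr_gt0// mu_le ?h1.
    rewrite ler_pdivlMr// lerBrDr lerBrDr.
    apply: le_trans (mu'M h qh); rewrite -addrA addrC (addrC delta).
    by rewrite lerD2l mulrC ler_pM2l// le_bigmax.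
  have lim : (2 <= q <= k)%N by rewrite q_gt1.
  apply: (closed_cvg (fun x => P mu sigma (rejection_region Y delta c q) <= x)%E
    _ near_ge _ (hc.2 q lim)).
  exact: closed_ereal_le_ereal.
(* A single true null.  The min-max form gives mu^_1 <= mean of group 1, so the
   error event lies in the rejection event of a two-sample t test. *)
- have q_eq1 : q = 1%N :> nat by apply/eqP; rewrite eqn_leq q_le1.
  have u0 : inord 1 != ord0 :> 'I_k.+1 by rewrite -val_eqE /= inordK.
  have hX := std_normal_family_error hmodel hmu hsigma.
  have mX : measurable_fun [set: T] (fun w =>
      ((standardized_error Y mu sigma)^~ w : sample_space _)).
    by apply: measurable_family => s; exact: hX.1.
  rewrite -tq -(two_sample_student hn t hX u0) -c1E.
  apply: le_measure; rewrite ?inE.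
  + exact: measurable_rejection_region.
  + have mstat := measurable_funM
      (measurable_funB (measurable_sample_mean (inord 1)) (measurable_sample_mean ord0))
      (measurableT_comp (@measurable_invr R) (measurable_root_mse (n := n))).
    have := measurableT_comp mstat mX.
    move=> /(_ measurableT `]c 1%N, +oo[%classic (measurable_itv _)).
    rewrite setTI; congr (measurable _).
    by apply/seteqP; split => w /=; rewrite in_itv/= andbT.
  rewrite (rejection_regionE hn Y delta c mu hsigma qk) => w [j].
  rewrite q_eq1 => /andP[j1 j_le1] /(_ 1%N)[|s /andP[s1 sj]].
    by rewrite j_le1.
  have -> : j = 1%N by apply/eqP; rewrite eqn_leq j_le1.
  have -> : s = 1%N by apply/eqP; rewrite eqn_leq s1 (leq_trans sj).
  move=> /lt_le_trans; apply; apply: ler_wpM2r.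
    by rewrite invr_ge0 sqrtr_ge0.
  have only1 (h : 'I_k.+1) : (1 <= h <= 1)%N = (h == inord 1).
    by rewrite -eqn_leq eq_sym -val_eqE/= inordK.
  rewrite /weighted_mean !(big_pred1 (inord 1) only1).
  rewrite mulrC mulKf ?pnatr_eq0 -?lt0n//.
  rewrite /standardized_gap gerDl pmulr_lle0 ?invr_gt0//.
  by apply: mu_le; rewrite inordK.
Qed.
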